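(* For all integers $n\ge 0$ and $r,k,i,j\ge 1$, the following congruences hold: \begin{align*} \bar{a}_{r,2^k}(2n+1)&\equiv0\pmod {2^{k+1}},\\ \bar{a}_{r,2^ki+2^{k-1}}(2n+1)&\equiv0\pmod {2^{k}},\\ \bar{a}_{2^{k+1}j+2^k-1,\, 2^ki+1}(4n+2)&\equiv 0\pmod {2^{k+1}},\\ \bar{a}_{2^{k+1}j+2^k,\, 2^ki}(4n+2)&\equiv 0\pmod {2^{k+1}},\\ \bar{a}_{2^{k+1}j+2^k-1,\, 2^ki+1}(4n+3)&\equiv 0\pmod {2^{k+2}},\\ \bar{a}_{2^{k+1}j+2^k,\, 2^ki}(4n+3)&\equiv 0\pmod {2^{k+2}},\\ \bar{a}_{2^{k+1}j+2^k,\, 2^ki}(8n+4)&\equiv 0 \pmod {2^{k+1}},\\ \bar{a}_{2^{k+1}j+2^k-1,\, 2^ki+1}(8n+5)&\equiv 0 \pmod {2^{k+2}}. \end{align*}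
   Context: For $m\ge1$ let $f_m:=\prod_{k=1}^{\infty}(1-q^{mk})$. For integers $r,s\ge1$, $\bar{a}_{r,s}(n)$ denotes the number of overpartitions of $n$ (partitions in which the first occurrence of each part size may be overlined) wherein each even part may appear in one of $r$ colors and each odd part in one of $s$ colors; its generating function is \[ \sum_{n=0}^{\infty}\bar{a}_{r,s}(n)q^n=\frac{f_2^{3s-2r}}{f_1^{2s}f_4^{s-r}}. \] *)

(* Defs.v *)
From mathcomp Require Import all_boot.

Set Implicit Arguments.
Unset Strict Implicit.
Unset Printing Implicit Defensive.

Definition ncolors (r s m : nat) : nat := if odd m then s else r.

(* The coloured parts that can occur in an overpartition of [n]: a pair
   [Tagged _ c] with tag [m : 'I_n] stands for the part size [m.+1] (so sizes
   run over 1, ..., n) in colour [c]. *)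
Definition cpart (r s n : nat) : finType :=
  {m : 'I_n & 'I_(ncolors r s m.+1)}.

Definition cpart_size (r s n : nat) (x : cpart r s n) : nat := (tag x).+1.

(* A coloured overpartition is given by, for each coloured part [x], its
   multiplicity [(f x).1] and whether its first occurrence is overlined,
   [(f x).2]; the latter requires that [x] occurs.  Copies of one size in
   different colours are different parts, each with its own overline; this is
   the convention giving the generating function
     \prod_(m >= 1) ((1 + q^m) / (1 - q^m)) ^ (ncolors r s m)
       = f_2^(3s-2r) / (f_1^(2s) f_4^(s-r)).
   Multiplicities in an overpartition of [n] never exceed [n], so bounding them
   by [n] loses nothing. *)
Definition coloured_overpartitions (r s n : nat) :
    {set {ffun cpart r s n -> 'I_n.+1 * bool}} :=
  [set f : {ffun cpart r s n -> 'I_n.+1 * bool}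
     | (\sum_(x : cpart r s n) cpart_size x * (f x).1 == n)
       && [forall x, (f x).2 ==> (0 < (f x).1)]].

Definition abar (r s n : nat) : nat := #|coloured_overpartitions r s n|.

(* Main.v *)
(** With phi(q) = 1 + 2 S, S = q + q^4 + q^9 + ..., Gauss' identity (in a
    telescoping finite form, taken at -q) says that the overpartition factors
    (1 + q^m) / (1 - q^m) over odd m have product phi(q) times their product P
    over even m.  Hence the generating function is phi^s P^(r+s), where P is a
    power series in q^2.  Since (1 + 2a)^(2^k) = 1 + 2^(k+1) (a + a^2) modulo
    2^(k+2), a coefficient of odd index depends, modulo 2^(k+2), only on phi^s,
    that is on the coefficients of S and S^2; those of S vanish at nonsquares,
    those of S^2 are even at odd indices.  The congruences modulo 2^(k+1) need
    only (1 + 2a)^(2^k) = 1 modulo 2^(k+1). *)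

Require Import Defs.
From mathcomp Require Import all_boot.
From mathcomp Require Import all_order all_algebra ring zify.

Set Implicit Arguments.
Unset Strict Implicit.
Unset Printing Implicit Defensive.

Import GRing.Theory.

Local Open Scope ring_scope.

(** * Gauss' identity and the overpartition factors *)

Section Theta.
Variables (A : comNzRingType) (x : A).

Definition square_sum (n : nat) : A := \sum_(1 <= j < n.+1) x ^+ (j ^ 2).

Definition theta (n : nat) : A := 1 + 2 * square_sum n.

(* [(1 + x^m) / (1 - x^m)] truncated: the two agree when [x^(n+1) = 0]. *)
Definition overfactor (n m : nat) : A :=
  1 + 2 * \sum_(1 <= a < n.+1) x ^+ (m * a).

Definition odd_overfactors (n : nat) : A :=
  \prod_(1 <= m < n.+1 | odd m) overfactor n m.

Definition even_overfactors (n : nat) : A :=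
  \prod_(1 <= m < n.+1 | ~~ odd m) overfactor n m.

Let gauss_rest (n s : nat) : A :=
  (-1) ^+ s * x ^+ (s * n.+1) * \prod_(1 <= j < s) (1 + x ^+ j)
    * \prod_(s.+1 <= j < n.+1) (1 - x ^+ j).

(* The remainder consists of terms divisible by [x^(n+1)]; its increments in [n]
   telescope in [s]. *)
Lemma finite_gauss (n : nat) :
  (1 + 2 * \sum_(1 <= j < n.+1) (-1) ^+ j * x ^+ (j ^ 2))
      * \prod_(1 <= m < n.+1) (1 + x ^+ m)
  = \prod_(1 <= m < n.+1) (1 - x ^+ m)
    + 2 * \sum_(1 <= s < n.+1) gauss_rest n s.
Proof.
elim: n => [|n IHn]; first by rewrite !big_geq //; ring.
(* [g] is a discrete antiderivative: the s-th increment of the remainder is [g s - g (s - 1)]. *)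
pose g s := (-1) ^+ s * x ^+ (s.+1 * n.+1) * \prod_(1 <= j < s.+1) (1 + x ^+ j)
    * \prod_(s.+1 <= j < n.+1) (1 - x ^+ j) : A.
have telescoped :
    \sum_(1 <= s < n.+1)
      ((1 + x ^+ n.+1) * gauss_rest n s - gauss_rest n.+1 s)
    = (-1) ^+ n * x ^+ (n.+1 * n.+1) * \prod_(1 <= j < n.+1) (1 + x ^+ j)
      - x ^+ n.+1 * \prod_(1 <= m < n.+1) (1 - x ^+ m).
  transitivity (g n - g 0%N); last first.
    by rewrite /g !(big_geq (leqnn _)) !mul1n expr0; ring.
  rewrite big_add1 /= -telescope_sumr //.
  apply: eq_big_nat => s /andP[_ lt_sn]; rewrite /gauss_rest /g.
  rewrite [\prod_(1 <= j < s.+2) _]big_nat_recr //=.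
  rewrite [\prod_(s.+2 <= j < n.+2) _]big_nat_recr //=.
  rewrite [\prod_(s.+1 <= j < n.+1) _]big_nat_recl ?big_add1 //=.
  have ->: (s.+1 * n.+2 = s.+1 * n.+1 + s.+1)%N by lia.
  have ->: (s.+2 * n.+1 = s.+1 * n.+1 + n.+1)%N by lia.
  rewrite !exprD ![(-1) ^+ s.+1]exprS; set e := (-1) ^+ s.
  set a := x ^+ (s.+1 * _); set b := x ^+ s.+1; set c := x ^+ n.+1.
  by set u := \prod_(0 <= i < s) _; set v := \prod_(s <= i < _) _; ring.
rewrite ![\prod_(1 <= _ < n.+2) _]big_nat_recr //=.
rewrite ![\sum_(1 <= _ < n.+2) _]big_nat_recr //=.
move: telescoped; rewrite big_split /= sumrN -big_distrr /=.
have ->: gauss_rest n.+1 n.+1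
    = (-1) ^+ n.+1 * x ^+ (n.+1 * n.+2) * \prod_(1 <= j < n.+1) (1 + x ^+ j).
  by rewrite /gauss_rest [\prod_(n.+2 <= _ < _) _]big_geq // mulr1.
move/eqP; rewrite subr_eq => /eqP telescoped.
have ->: (n.+1 * n.+2 = n.+1 * n.+1 + n.+1)%N by lia.
rewrite -mulnn !exprD [(-1) ^+ n.+1]exprS.
move: IHn telescoped.
move: (\sum_(_ <= _ < _) _) (\prod_(_ <= _ < _) (1 + _)) => S D.
move: (\prod_(_ <= _ < _) _) (\sum_(_ <= _ < _) _) (\sum_(_ <= _ < _) _).
move: ((-1) ^+ n) (x ^+ (n.+1 * n.+1)) (x ^+ n.+1) => e a b N T1 T IHn tel.
(* Split off the new square term, so that the induction hypothesis applies to the rest, multiplied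
   by the new factor [1 + b]. *)
transitivity ((1 + 2 * S) * D * (1 + b) + 2 * (- e * a) * D * (1 + b)).
  by ring.
rewrite IHn.
transitivity (N * (1 + b) + 2 * ((1 + b) * T) - 2 * e * a * D * (1 + b)).
  by ring.
by rewrite tel; ring.
Qed.

(** Since j and j^2 have the same parity, the signs in Gauss' identity cancel at [- x]. *)
Lemma theta_opp (n : nat) :
  theta n = 1 + 2 * \sum_(1 <= j < n.+1) (-1) ^+ j * (- x) ^+ (j ^ 2).
Proof.
rewrite /theta /square_sum; congr (1 + 2 * _); apply: eq_bigr => j _.
rewrite [(- x) ^+ _]exprNn mulrA -exprD -signr_odd.
by rewrite oddD oddX /= addbb mul1r.
Qed.

Lemma overfactor_mulB (n m : nat) : x ^+ n.+1 = 0 -> (0 < m)%N ->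
  overfactor n m * (1 - x ^+ m) = 1 + x ^+ m.
Proof.
move=> xn0 m_gt0.
have geom : (1 - x ^+ m) * (\sum_(0 <= a < n.+1) x ^+ (m * a)) = 1.
  rewrite big_mkord (eq_bigr (fun a : 'I_ _ => (x ^+ m) ^+ a)); last first.
    by move=> a _; rewrite exprM.
  rewrite -[RHS]subr0 -[0 in RHS](_ : (x ^+ m) ^+ n.+1 = 0).
    by rewrite -[in RHS](expr1n _ n.+1) subrXX; under [in RHS]eq_bigr
      => i _ do rewrite expr1n mul1r.
  by rewrite exprAC xn0 expr0n; case: m m_gt0.
have: overfactor n m = 2 * (\sum_(0 <= a < n.+1) x ^+ (m * a)) - 1.
  by rewrite big_nat_recl // muln0 expr0 /overfactor big_add1 /=; ring.
move=> ->; rewrite mulrBl -mulrA [_ * (1 - _) in X in 2 * X]mulrC geom; ring.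
Qed.

(** Lets denominators be cancelled in a ring with nilpotents: each factor has a finite geometric
    series as inverse. *)
Lemma prod1B_unit (n : nat) : x ^+ n.+1 = 0 ->
  exists y, (\prod_(1 <= m < n.+1) (1 - x ^+ m)) * y = 1.
Proof.
move=> xn0; rewrite big_add1 /=.
elim: (n in \prod_(_ <= _ < n) _) => [|k [y yP]].
  by exists 1; rewrite big_geq // mulr1.
pose z := \sum_(i < n.+1) (x ^+ k.+1) ^+ i.
exists (y * z); rewrite big_nat_recr //= mulrACA yP mul1r /z.
have {2}->: 1 = 1 ^+ n.+1 - (x ^+ k.+1) ^+ n.+1.
  by rewrite expr1n exprAC xn0 expr0n subr0.
rewrite subrXX; congr (_ * _); apply: eq_bigr => i _.
by rewrite expr1n mul1r.
Qed.
End Theta.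

(** Passing to [- x] exchanges 1 + x^m and 1 - x^m for odd m only. So Gauss' identity balances the
    odd quotients (1 + x^m) / (1 - x^m) against theta times the even ones. *)
Lemma odd_overfactorsE (A : comNzRingType) (x : A) (n : nat) :
  x ^+ n.+1 = 0 ->
  odd_overfactors x n = theta x n * even_overfactors x n.
Proof.
move=> xn0.
have gauss : theta x n * \prod_(1 <= m < n.+1) (1 + (- x) ^+ m)
    = \prod_(1 <= m < n.+1) (1 - (- x) ^+ m).
  rewrite theta_opp finite_gauss [X in 2 * X]big_nat.
  rewrite [X in 2 * X]big1 ?mulr0 ?addr0 //.
  (* The sum starts at 1, so every remainder term contains a positive power of (- x)^(n+1) = 0. *)
  case=> // s _; rewrite mulnC exprM [(- x) ^+ _]exprNn xn0 mulr0 expr0n.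
  by rewrite mulr0 !mul0r.
have [y yP] := prod1B_unit xn0.
rewrite -[LHS]mulr1 -[RHS]mulr1 -yP !mulrA; congr (_ * y).
have sgnx m (b : bool) : odd m = b -> (- x) ^+ m = (-1) ^+ b * x ^+ m.
  by move=> <-; rewrite signr_odd; exact: exprNn.
have plusE : \prod_(1 <= m < n.+1) (1 + (- x) ^+ m)
    = \prod_(1 <= m < n.+1 | odd m) (1 - x ^+ m)
      * \prod_(1 <= m < n.+1 | ~~ odd m) (1 + x ^+ m).
  rewrite (bigID odd) /=; congr (_ * _); apply: eq_bigr => m.
    by move/sgnx->; rewrite mulN1r.
  by move/negbTE/sgnx->; rewrite mul1r.
have minusE : \prod_(1 <= m < n.+1) (1 - (- x) ^+ m)
    = \prod_(1 <= m < n.+1 | odd m) (1 + x ^+ m)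
      * \prod_(1 <= m < n.+1 | ~~ odd m) (1 - x ^+ m).
  rewrite (bigID odd) /=; congr (_ * _); apply: eq_bigr => m.
    by move/sgnx->; rewrite mulN1r opprK.
  by move/negbTE/sgnx->; rewrite mul1r.
have mulB (P : pred nat) :
    \prod_(1 <= m < n.+1 | P m) overfactor x n m
      * \prod_(1 <= m < n.+1 | P m) (1 - x ^+ m)
    = \prod_(1 <= m < n.+1 | P m) (1 + x ^+ m).
  rewrite -big_split big_nat_cond [RHS]big_nat_cond /=; apply: eq_bigr => m.
  by case/andP=> /andP[m_gt0 _] _; apply: overfactor_mulB.
rewrite [\prod_(1 <= m < n.+1) (1 - x ^+ m)](bigID odd) /=.
transitivity (odd_overfactors x n * \prod_(1 <= m < n.+1 | odd m) (1 - x ^+ m)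
  * \prod_(1 <= m < n.+1 | ~~ odd m) (1 - x ^+ m)); first by rewrite mulrA.
rewrite [odd_overfactors x n * _]mulB -minusE -gauss plusE.
by rewrite -(mulB (predC odd)) /even_overfactors /=; ring.
Qed.

(** * Counting coloured overpartitions by a product *)

Lemma overfactor_pairs (A : comNzRingType) (x : A) (n m : nat) :
  overfactor x n m
  = \sum_(j : 'I_n.+1 * bool)
      (if j.2 ==> (0 < j.1)%N then x ^+ (m * j.1) else 0).
Proof.
rewrite -(pair_bigA _ (fun (a : 'I_n.+1) (b : bool) =>
  if b ==> (0 < a)%N then x ^+ (m * a) else 0)) /=.
(* Multiplicity 0 admits no overline and gives the 1; a positive one occurs with and without
   overline, whence the 2. *)
rewrite big_ord_recl /= big_bool /= muln0 add0r /overfactor; congr (_ + _).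
rewrite mulr_sumr big_add1 big_mkord; apply: eq_bigr => a _.
by rewrite big_bool /= mulr2n mulrDl mul1r.
Qed.

Lemma prod_cpart (A : comNzRingType) (x : A) (r s n : nat) :
  \prod_(y : cpart r s n) overfactor x n (cpart_size y)
  = odd_overfactors x n ^+ s * even_overfactors x n ^+ r.
Proof.
rewrite /cpart_size -(sig_big_dep predT (fun _ => predT)
  (fun (m : 'I_n) (_ : 'I_(ncolors r s m.+1)) => overfactor x n m.+1)).
rewrite (eq_bigr (fun m : 'I_n => overfactor x n m.+1 ^+ ncolors r s m.+1));
  last by move=> m _; rewrite prodr_const card_ord.
rewrite -(big_mkord predT (fun m => overfactor x n m.+1 ^+ ncolors r s m.+1)).
rewrite -(big_add1 _ _ 0 n.+1 predT (fun m => overfactor x n m ^+ ncolors r s m)).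
rewrite (bigID odd) /= /odd_overfactors /even_overfactors -!prodrXl.
congr (_ * _); apply: eq_bigr => m; rewrite /ncolors.
  by move=> ->.
by move=> /negbTE->.
Qed.

(** Distributing the product over the sums indexes its terms by the functions [f]; a forbidden
    overline puts a zero factor in the term. *)
Lemma abar_coef (r s n : nat) :
  (abar r s n)%:R =
  (odd_overfactors 'X n ^+ s * even_overfactors 'X n ^+ r : {poly int})`_n.
Proof.
rewrite -prod_cpart; under eq_bigr do rewrite overfactor_pairs.
rewrite bigA_distr_bigA coef_sum /abar -sum1_card natr_sum big_mkcond /=.
apply: eq_bigr => f _; rewrite inE.
case: (boolP [forall x, _]) => [/forallP over_ok | ]; last first.
  rewrite negb_forall => /existsP[y /negbTE y_bad].
  by rewrite andbF (bigD1 y) //= y_bad mul0r coef0.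
rewrite (eq_bigr (fun y => 'X^(cpart_size y * (f y).1))); last first.
  by move=> y _; rewrite over_ok.
rewrite prodrXr coefXn andbT eq_sym.
by case: eqP.
Qed.

(** * Truncation modulo X^(n+1) *)

Lemma val_in_qpolyXn (A : comNzRingType) (n : nat) (p : {poly A}) :
  val (in_qpoly 'X^(n.+1) p) = take_poly n.+1 p.
Proof. by rewrite /= mk_monic_Xn Pdiv.RingMonic.take_poly_rmodp. Qed.

Lemma in_qpolyXn_coef (A : comNzRingType) (n i : nat) (p q : {poly A}) :
  in_qpoly 'X^(n.+1) p = in_qpoly 'X^(n.+1) q -> (i <= n)%N -> p`_i = q`_i.
Proof.
move/(congr1 val); rewrite !val_in_qpolyXn => eq_pq le_in.
by have /(congr1 (coefp i)) := eq_pq; rewrite /= !coef_take_poly ltnS le_in.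
Qed.

Lemma in_qpolyXn_nilpotent (A : comNzRingType) (n : nat) :
  (in_qpoly 'X^(n.+1) ('X : {poly A})) ^+ n.+1 = 0.
Proof.
rewrite -rmorphXn; apply: val_inj; rewrite val_in_qpolyXn.
by apply/polyP => i; rewrite coef_take_poly coefXn coef0; case: ltngtP.
Qed.

Section Morph.
Variables (A B : comNzRingType) (f : {rmorphism A -> B}) (x : A) (n : nat).

Lemma rmorph_overfactor m : f (overfactor x n m) = overfactor (f x) n m.
Proof.
rewrite /overfactor rmorphD rmorphM rmorph1 rmorph_nat rmorph_sum.
congr (_ + _ * _); apply: eq_bigr => a _; exact: rmorphXn.
Qed.

Lemma rmorph_theta : f (theta x n) = theta (f x) n.
Proof.
rewrite /theta /square_sum rmorphD rmorphM rmorph1 rmorph_nat rmorph_sum.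
congr (_ + _ * _); apply: eq_bigr => a _; exact: rmorphXn.
Qed.

Lemma rmorph_odd_overfactors :
  f (odd_overfactors x n) = odd_overfactors (f x) n.
Proof.
by rewrite rmorph_prod; apply: eq_bigr => m _; exact: rmorph_overfactor.
Qed.

Lemma rmorph_even_overfactors :
  f (even_overfactors x n) = even_overfactors (f x) n.
Proof.
by rewrite rmorph_prod; apply: eq_bigr => m _; exact: rmorph_overfactor.
Qed.
End Morph.

(** [odd_overfactorsE] requires a nilpotent, so it is applied to the class of ['X] modulo X^(n+1),
    which still determines coefficient n. *)
Lemma abar_theta (r s n : nat) :
  (abar r s n)%:R =
  (theta 'X n ^+ s * even_overfactors 'X n ^+ (r + s) : {poly int})`_n.
Proof.
rewrite abar_coef; apply: (@in_qpolyXn_coef _ n) => //.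
rewrite !rmorphM /= !rmorphXn /= rmorph_theta.
rewrite rmorph_odd_overfactors rmorph_even_overfactors.
rewrite odd_overfactorsE ?in_qpolyXn_nilpotent // exprMn -mulrA -exprD.
by rewrite addnC.
Qed.

(** * Powers of 1 + 2a modulo powers of 2 *)

Lemma expr_1D2_pow2 (A : comNzRingType) (a : A) (k : nat) :
  exists b, (1 + 2 * a) ^+ (2 ^ k.+1)
    = 1 + 2 ^+ k.+2 * (a + a ^+ 2) + 2 ^+ k.+3 * b.
Proof.
(* The induction starts at exponent 2, because 1 + 2a and 1 + 2(a + a^2) differ modulo 4 in
   general. *)
elim: k => [|k [b IHk]]; first by exists 0; rewrite expn1; ring.
rewrite expnSr exprM IHk.
(* Squaring doubles the previous terms; the last summand comes from (2^(k+2))^2 = 2^(k+4) 2^k. *)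
exists (b + 2 ^+ k * (a + a ^+ 2 + 2 * b) ^+ 2); rewrite !exprS; ring.
Qed.

Lemma expr_1D2_pow2M (A : comNzRingType) (a : A) (k i : nat) :
  exists b, (1 + 2 * a) ^+ (2 ^ k.+1 * i)
    = 1 + 2 ^+ k.+2 * (i%:R * (a + a ^+ 2)) + 2 ^+ k.+3 * b.
Proof.
have [b bP] := expr_1D2_pow2 a k; set t := a + a ^+ 2 in bP *.
elim: i => [|i [c IHi]]; first by exists 0; rewrite muln0; ring.
rewrite mulnS exprD bP IHi.
exists (b + c + 2 ^+ k.+1 * (t + 2 * b) * (t * i%:R + 2 * c)).
rewrite -[i.+1]addn1 natrD !exprS; ring.
Qed.

(** Coarser than [expr_1D2_pow2M], but it includes [k = 0]. *)
Lemma expr_1D2_dvd (A : comNzRingType) (a : A) (k i : nat) :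
  exists b, (1 + 2 * a) ^+ (2 ^ k * i) = 1 + 2 ^+ k.+1 * b.
Proof.
case: k => [|k]; last first.
  have [b ->] := expr_1D2_pow2M a k i; exists (i%:R * (a + a ^+ 2) + 2 * b).
  by rewrite !exprS; ring.
rewrite expn0 mul1n; elim: i => [|i [b IHi]]; first by exists 0; ring.
by exists (a + b + 2 * a * b); rewrite exprS IHi; ring.
Qed.

Lemma prod_1D2 (A : comNzRingType) (n : nat) (P : pred nat) (F : nat -> A) :
  exists b, \prod_(1 <= m < n | P m) (1 + 2 * F m) = 1 + 2 * b.
Proof.
apply: (big_ind (fun p => exists b, p = 1 + 2 * b)).
- by exists 0; ring.
- by move=> _ _ [b ->] [c ->]; exists (b + c + 2 * b * c); ring.
- by move=> m _; exists (F m).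
Qed.

(** * Coefficients at odd indices *)

Lemma even_overfactors_comp (A : comNzRingType) (n : nat) :
  exists p : {poly A}, even_overfactors 'X n = p \Po 'X^2.
Proof.
exists (\prod_(1 <= m < n.+1 | ~~ odd m) overfactor 'X n m./2).
rewrite (rmorph_prod (comp_poly 'X^2)); apply: eq_bigr => m m_even.
rewrite rmorph_overfactor /= comp_polyX /overfactor.
congr (_ + _ * _); apply: eq_bigr => a _.
by rewrite -exprM mulnA mul2n even_halfK.
Qed.

Lemma coef_comp_X2_odd (A : comNzRingType) (p : {poly A}) (n : nat) :
  odd n -> (p \Po 'X^2)`_n = 0.
Proof. by move=> n_odd; rewrite coef_comp_poly_Xn // dvdn2 n_odd. Qed.

(** Write p = e + o X with e and o in X^2: only the cross term 2 e o X of the square has odd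
    exponents. *)
Lemma coef_sqr_odd (A : comNzRingType) (p : {poly A}) (n : nat) :
  odd n -> exists c, (p ^+ 2)`_n = 2 * c.
Proof.
move=> n_odd; rewrite -(poly_even_odd p).
set e := even_poly p \Po _; set o := odd_poly p \Po _.
exists (e * (o * 'X))`_n.
have ->: (e + o * 'X) ^+ 2
    = (even_poly p ^+ 2 + odd_poly p ^+ 2 * 'X) \Po 'X^2 + 2 * (e * (o * 'X)).
  by rewrite expr2 comp_polyD !comp_polyM comp_polyX -/e -/o; ring.
by rewrite coefD coef_comp_X2_odd // add0r !mulr_natl coefMn.
Qed.

(** * Divisibility of [abar] by powers of 2 *)

Lemma coef_pow2M (p : {poly int}) (M n : nat) : (2 ^+ M * p)`_n = 2 ^+ M * p`_n.
Proof. by rewrite -!natrX !mulr_natl coefMn. Qed.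

Lemma eq0_mod_pow2 (a M : nat) (c : int) :
  a%:R = 2 ^+ M * c -> a = 0 %[mod 2 ^ M].
Proof.
rewrite natz => ac; apply/eqP; rewrite mod0n -/(dvdn _ _) -[a]absz_nat ac.
by rewrite abszM abszX dvdn_mulr.
Qed.

Lemma coef_square_sum (A : comNzRingType) (n : nat) :
  (forall j, j ^ 2 != n)%N -> (square_sum ('X : {poly A}) n)`_n = 0.
Proof.
move=> nsq; rewrite /square_sum coef_sum big1 // => j _.
by rewrite coefXn eq_sym (negbTE (nsq j)).
Qed.

(** Modulo 2^(k+1) the odd factors contribute 1, which leaves a polynomial in X^2. *)
Lemma abar_odd_dvd (r k c n : nat) : odd n ->
  abar r (2 ^ k * c) n = 0 %[mod 2 ^ k.+1].
Proof.
move=> n_odd.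
have [a aP] := prod_1D2 n.+1 odd
  (fun m => \sum_(1 <= b < n.+1) ('X : {poly int}) ^+ (m * b)).
have [h hP] := expr_1D2_dvd a k c.
have [p pP] := even_overfactors_comp int n.
apply: (@eq0_mod_pow2 _ _ (h * even_overfactors 'X n ^+ r)`_n).
rewrite abar_coef /odd_overfactors aP hP mulrDl mul1r -mulrA coefD coef_pow2M.
by rewrite pP -(rmorphXn (comp_poly 'X^2)) /= coef_comp_X2_odd ?add0r.
Qed.

(** Both products are 1 + 2b, so their powers are 1 modulo 2^(k+1) and only the constant term
    survives. *)
Lemma abar_pow2_dvd (k c d n : nat) : (0 < n)%N ->
  abar (2 ^ k * d) (2 ^ k * c) n = 0 %[mod 2 ^ k.+1].
Proof.
move=> n_gt0.
have [a aP] := prod_1D2 n.+1 odd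
  (fun m => \sum_(1 <= b < n.+1) ('X : {poly int}) ^+ (m * b)).
have [b bP] := prod_1D2 n.+1 (predC odd)
  (fun m => \sum_(1 <= b < n.+1) ('X : {poly int}) ^+ (m * b)).
have [h hP] := expr_1D2_dvd a k c.
have [g gP] := expr_1D2_dvd b k d.
apply: (@eq0_mod_pow2 _ _ (h + g + 2 ^+ k.+1 * (h * g))`_n).
rewrite abar_coef /odd_overfactors /even_overfactors aP bP hP gP.
have ->: (1 + 2 ^+ k.+1 * h) * (1 + 2 ^+ k.+1 * g)
  = 1 + 2 ^+ k.+1 * (h + g + 2 ^+ k.+1 * (h * g)) by ring.
by rewrite coefD coef1 coef_pow2M eqn0Ngt n_gt0 add0r.
Qed.

(** Here phi^s P^(r+s) reduces to phi modulo 2^(k+1), because s - 1 and r + s are multiples of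
    2^k. *)
Lemma abar_nonsquare_dvd (r k c d n : nat) :
  (forall j, j ^ 2 != n)%N -> (r + (2 ^ k * c).+1 = 2 ^ k * d)%N ->
  abar r (2 ^ k * c).+1 n = 0 %[mod 2 ^ k.+1].
Proof.
move=> nsq rsE; pose S := square_sum ('X : {poly int}) n.
have n_neq0 : (n == 0)%N = false by rewrite eq_sym; apply/negbTE/(nsq 0%N).
have [b bP] := prod_1D2 n.+1 (predC odd)
  (fun m => \sum_(1 <= b < n.+1) ('X : {poly int}) ^+ (m * b)).
have [h hP] := expr_1D2_dvd S k c.
have [g gP] := expr_1D2_dvd b k d.
apply: (@eq0_mod_pow2 _ _
  ((1 + 2 * S) * (h + g + 2 ^+ k.+1 * (h * g)))`_n).
rewrite abar_theta rsE /even_overfactors bP gP exprS hP.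
have ->: theta 'X n * (1 + 2 ^+ k.+1 * h) * (1 + 2 ^+ k.+1 * g)
  = 1 + 2 ^+ 1 * S
    + 2 ^+ k.+1 * ((1 + 2 * S) * (h + g + 2 ^+ k.+1 * (h * g))).
  by rewrite /theta -/S; ring.
by rewrite !coefD coef1 !coef_pow2M coef_square_sum // n_neq0 mulr0 !add0r.
Qed.

(** The bit [e] treats s = 2^(k+1) c and s = 2^(k+1) c + 1 together; it only adds a multiple of S
    modulo 2^(k+3). *)
Lemma abar_odd_nonsquare_dvd (r k c d n : nat) (e : bool) : odd n ->
  (forall j, j ^ 2 != n)%N -> (r + (2 ^ k.+1 * c + e) = 2 ^ k.+1 * d)%N ->
  abar r (2 ^ k.+1 * c + e) n = 0 %[mod 2 ^ k.+3].
Proof.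
move=> n_odd nsq rsE; pose S := square_sum ('X : {poly int}) n.
have n_neq0 : (n == 0)%N = false by rewrite eq_sym; apply/negbTE/(nsq 0%N).
have [b bP] := prod_1D2 n.+1 (predC odd)
  (fun m => \sum_(1 <= b < n.+1) ('X : {poly int}) ^+ (m * b)).
have [t tP] := expr_1D2_pow2M S k c.
have [g gP] := expr_1D2_dvd b k.+1 d.
have [v vP] := expr_1D2_dvd S 0 (2 ^ k.+1 * c + e).
have [p pP] := even_overfactors_comp int n.
have [w wP] := coef_sqr_odd S n_odd.
(* 2^(k+2) g is a power of P minus 1, hence has no odd coefficients. *)
have g0 : 2 ^+ k.+2 * g`_n = 0.
  rewrite -coef_pow2M -[RHS](coef_comp_X2_odd (p ^+ (2 ^ k.+1 * d)) n_odd).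
  rewrite [in RHS]rmorphXn /= -pP /even_overfactors bP gP.
  by rewrite coefD coef1 n_neq0 add0r.
have eP : (1 + 2 * S) ^+ e = 1 + 2 ^+ 1 * (e%:R * S).
  by case: e {rsE vP}; rewrite /= ?expr0; ring.
(* The second summand of [u] is the product of 2 e S with the 2^(k+2) term. *)
pose u := (1 + 2 * (e%:R * S)) * t + e%:R * S * (c%:R * (S + S ^+ 2)).
have thE : theta 'X n ^+ (2 ^ k.+1 * c + e)
    = 1 + 2 ^+ 1 * (e%:R * S) + 2 ^+ k.+2 * (c%:R * (S + S ^+ 2))
      + 2 ^+ k.+3 * u.
  by rewrite exprD /theta -/S tP eP /u !exprS; ring.
clearbody u.
(* As phi^s = 1 + 2v, multiplying by it changes 2^(k+2) g only by a multiple of 2^(k+3). *)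
have gE : theta 'X n ^+ (2 ^ k.+1 * c + e) * (2 ^+ k.+2 * g)
    = 2 ^+ k.+2 * g + 2 ^+ k.+3 * (v * g).
  by move: vP; rewrite expn0 mul1n /theta -/S => ->; rewrite !exprS; ring.
apply: (@eq0_mod_pow2 _ _ (c%:R * w + u`_n + (v * g)`_n)).
rewrite abar_theta rsE /even_overfactors bP gP mulrDr mulr1 gE thE.
rewrite !mulr_natl !coefD !coef_pow2M !coefMn coefD coef1 wP.
rewrite !coef_square_sum // n_neq0 g0 mul0rn mulr0n.
by rewrite !add0r -(mulr_natl w) -(mulr_natl (2 * w)) !exprS; ring.
Qed.

Lemma sqr_mod8 (j : nat) : (j ^ 2 %% 8 \in [:: 0; 1; 4])%N.
Proof.
by rewrite -modnXm; move: (j %% 8)%N (ltn_pmod j (isT : 0 < 8)%N);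
  do 8! [case=> //].
Qed.

Local Close Scope ring_scope.

Theorem theorem1p6 (n r k i j : nat)
    (hr : 1 <= r) (hk : 1 <= k) (hi : 1 <= i) (hj : 1 <= j) :
  abar r (2 ^ k) (2 * n + 1) = 0 %[mod 2 ^ (k + 1)] /\
  abar r (2 ^ k * i + 2 ^ (k - 1)) (2 * n + 1) = 0 %[mod 2 ^ k] /\
  abar (2 ^ (k + 1) * j + 2 ^ k - 1) (2 ^ k * i + 1) (4 * n + 2)
    = 0 %[mod 2 ^ (k + 1)] /\
  abar (2 ^ (k + 1) * j + 2 ^ k) (2 ^ k * i) (4 * n + 2)
    = 0 %[mod 2 ^ (k + 1)] /\
  abar (2 ^ (k + 1) * j + 2 ^ k - 1) (2 ^ k * i + 1) (4 * n + 3)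
    = 0 %[mod 2 ^ (k + 2)] /\
  abar (2 ^ (k + 1) * j + 2 ^ k) (2 ^ k * i) (4 * n + 3)
    = 0 %[mod 2 ^ (k + 2)] /\
  abar (2 ^ (k + 1) * j + 2 ^ k) (2 ^ k * i) (8 * n + 4)
    = 0 %[mod 2 ^ (k + 1)] /\
  abar (2 ^ (k + 1) * j + 2 ^ k - 1) (2 ^ k * i + 1) (8 * n + 5)
    = 0 %[mod 2 ^ (k + 2)].
Proof.
have k_pred : (k - 1).+1 = k by rewrite subn1 prednK.
have k_double : 2 ^ k = 2 * 2 ^ (k - 1) by rewrite -expnS k_pred.
have k_gt0 : 0 < 2 ^ k by rewrite expn_gt0.
have nsq m : m %% 8 \notin [:: 0; 1; 4] -> forall a, a ^ 2 != m.
  by move=> m8 a; apply: contraNneq m8 => <-; exact: sqr_mod8.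
(* Both colour families satisfy r + s = 2^k (2j + 1 + i); [e] tells them apart. *)
have odd_nonsquare r' m (e : bool) : odd m -> m %% 8 \notin [:: 0; 1; 4] ->
    r' + (2 ^ k * i + e) = 2 ^ k * (2 * j + 1 + i) ->
    abar r' (2 ^ k * i + e) m = 0 %[mod 2 ^ k.+2].
  move=> m_odd /nsq m_nsq.
  have := @abar_odd_nonsquare_dvd r' (k - 1) i (2 * j + 1 + i) m e m_odd m_nsq.
  by rewrite k_pred.
rewrite !(addn2 k) !(addn1 k).
have ->: 2 ^ k.+1 * j + 2 ^ k = 2 ^ k * (2 * j + 1) by rewrite expnS; nia.
repeat split.
- by rewrite -[X in abar r X]muln1; apply: abar_odd_dvd; lia.
- have := @abar_odd_dvd r (k - 1) (2 * i + 1) (2 * n + 1); rewrite k_pred.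
  have ->: 2 ^ (k - 1) * (2 * i + 1) = 2 ^ k * i + 2 ^ (k - 1).
    by rewrite k_double; nia.
  by apply; lia.
- rewrite [_ * i + 1]addn1; apply: (@abar_nonsquare_dvd _ _ _ (2 * j + 1 + i)).
    by apply: nsq; rewrite !inE; lia.
  by nia.
- by apply: abar_pow2_dvd; lia.
- by apply: (odd_nonsquare _ _ true); rewrite ?inE /=; nia.
- rewrite -[_ * i]addn0.
  by apply: (odd_nonsquare _ _ false); rewrite ?inE /=; nia.
(* 8n + 4 may be a square; the argument rests on both colour numbers being multiples of 2^k. *)
- by apply: abar_pow2_dvd; lia.
- by apply: (odd_nonsquare _ _ true); rewrite ?inE /=; nia.
Qed.
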